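(* The following hold. (1) A frame isomorphism is skinny. (2) A frame surjection is skinny. (3) The composition of skinny frame homomorphisms is skinny. (4) If $e$ is a frame surjection and $m$ is a frame homomorphism such that $m\circ e$ is skinny, then $m$ is skinny. (5) The full subcategory $\mathbf{plFs}$ of pointless frames is epireflective in $\mathbf{Fs}$.
   Context: All frames are completely regular (the one-element frame is allowed); frame homomorphisms preserve finite meets and arbitrary joins. $\max L$ is the set of maximal elements of $L\setminus\{\top\}$. A frame $L$ is pointless if $\max L=\emptyset$. An element $c$ is a successor of $a$ if $c>a$ and there is no $b$ with $a<b<c$. $\pi L=\{a\in L:a\text{ has no successor}\}$ is a sublocale of $L$, with quotient map $\pi_L:L\to\pi L$, $\pi_L(b)=\bigwedge\{a\in\pi L:a\ge b\}$. A frame homomorphism $m:L\to M$ is skinny if $\pi_M(m(a))=\top$ for all $a\in\max L$. $\mathbf{Fs}$ is the category whose objects are frames and whose morphisms are the skinny frame homomorphisms. *)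

(* Defs.v *)
From HB Require Import structures.
From mathcomp Require Import all_boot all_order all_algebra.
From mathcomp Require Import boolp classical_sets functions.
Set Implicit Arguments.
Unset Strict Implicit.
Unset Printing Implicit Defensive.
Import Order.TTheory.
Local Open Scope classical_set_scope.
Local Open Scope order_scope.

(* [\bot = \top] is not excluded, so the one-element frame is a frame. *)
HB.mixin Record TBDistrLattice_isFrame d T of Order.TBDistrLattice d T := {
  bigjoin : set T -> T;
  bigjoinP : forall A : set T, supremums A (bigjoin A);
  meet_bigjoin : forall (x : T) (A : set T),
    x `&` bigjoin A = bigjoin [set x `&` a | a in A]
}.

#[short(type="frameType")]
HB.structure Definition Frame d :=
  { T of Order.TBDistrLattice d T & TBDistrLattice_isFrame d T }.

Section FrameTheory.
Context {d : Order.disp_t} {L : frameType d}.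
Implicit Types (a b : L) (A : set L).

Definition bigmeet A : L := bigjoin (lbound A).

Definition pseudocompl a : L := bigjoin [set x : L | a `&` x = \bot].

Definition rather_below a b : Prop := pseudocompl a `|` b = \top.

(* The values of the scale [c] outside the rational interval [0, 1] are
   irrelevant. *)
Definition completely_below a b : Prop :=
  exists c : rat -> L,
    [/\ c 0%R = a, c 1%R = b &
        forall p q : rat, (0 <= p)%R -> (p < q)%R -> (q <= 1)%R ->
          rather_below (c p) (c q)].

Definition max_set : set L :=
  [set a | a != \top /\ forall b, b != \top -> a <= b -> b = a].

Definition successor a c : Prop := a < c /\ ~ exists b, a < b < c.

Definition pi_set : set L := [set a | ~ exists c, successor a c].

(* The quotient map onto the sublocale [pi_set], as a map into [L] itself:
   meets of elements of a sublocale, and its top, are those of [L]. *)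
Definition pi_map b : L := bigmeet [set a : L | pi_set a /\ b <= a].

End FrameTheory.
Arguments max_set {d} L.
Arguments pi_set {d} L.

HB.mixin Record Frame_isCompletelyRegular d T of Frame d T := {
  completely_regularP : forall b : T,
    b = bigjoin [set a : T | completely_below a b]
}.

#[short(type="crFrameType")]
HB.structure Definition CRFrame d :=
  { T of Frame d T & Frame_isCompletelyRegular d T }.

Definition pointless d (L : crFrameType d) : Prop := max_set L = set0.

(* [\bot] is the join of the empty set, so its preservation is included. *)
Definition frame_hom d d' (L : crFrameType d) (M : crFrameType d')
    (m : L -> M) : Prop :=
  [/\ m \top = \top,
      {morph m : x y / x `&` y} &
      forall A : set L, m (bigjoin A) = bigjoin (m @` A)].

Definition frame_iso d d' (L : crFrameType d) (M : crFrameType d')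
    (m : L -> M) : Prop :=
  frame_hom m /\ exists n : M -> L, [/\ frame_hom n, cancel m n & cancel n m].

Definition frame_surjection d d' (L : crFrameType d) (M : crFrameType d')
    (m : L -> M) : Prop :=
  frame_hom m /\ set_surj [set: L] [set: M] m.

Definition skinny d d' (L : crFrameType d) (M : crFrameType d')
    (m : L -> M) : Prop :=
  frame_hom m /\ forall a : L, max_set L a -> pi_map (m a) = \top.

(* Fs: the objects are all completely regular frames and the morphisms are the
   functions satisfying [skinny], composed as functions. *)

Definition Fs_iso d d' (L : crFrameType d) (M : crFrameType d') (m : L -> M)
    : Prop :=
  skinny m /\ exists n : M -> L, [/\ skinny n, cancel m n & cancel n m].

Definition Fs_epi d d' (L : crFrameType d) (M : crFrameType d') (e : L -> M)
    : Prop :=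
  skinny e /\
  forall (d'' : Order.disp_t) (N : crFrameType d'') (f g : M -> N),
    skinny f -> skinny g -> f \o e = g \o e -> f = g.

(* A full subcategory of Fs is given by a class [C] of objects. *)

Definition Fs_reflection (C : forall d, crFrameType d -> Prop)
    d d' (L : crFrameType d) (P : crFrameType d') (r : L -> P) : Prop :=
  [/\ C d' P, skinny r &
      forall (d'' : Order.disp_t) (M : crFrameType d'') (f : L -> M),
        C d'' M -> skinny f -> exists! g : P -> M, skinny g /\ g \o r = f].

(* Epireflective: isomorphism-closed, and every object has a reflection arrow
   that is an epimorphism of the ambient category. *)
Definition Fs_epireflective (C : forall d, crFrameType d -> Prop) : Prop :=
  (forall (d d' : Order.disp_t) (L : crFrameType d) (M : crFrameType d')
      (m : L -> M), Fs_iso m -> C d L -> C d' M) /\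
  (forall (d : Order.disp_t) (L : crFrameType d),
    exists (d' : Order.disp_t) (P : crFrameType d') (r : L -> P),
      Fs_reflection C r /\ Fs_epi r).

(* Main.v *)
Require Import Defs.
From mathcomp Require Import all_boot all_order.
From HB Require Import structures.
From mathcomp Require Import boolp classical_sets functions.

(** Everything follows from a description of [pi_set] by points.  In a regular
    frame the maximal elements are exactly the primes.  If [c] is a successor
    of [a], the implication [c -> a] is prime, hence maximal; conversely, if
    [p] is maximal and [c `&` p <= a] while [c] is not below [a], then
    [c `|` a] is a successor of [a].  So [a] lies in [pi_set L] if and only if
    [(p -> a) <= a] for every maximal [p] ([pi_setP]): [pi_set L] is the
    intersection of the open sublocales given by the maximal elements.  It is
    therefore closed under meets and under [x -> _], and [pi_map] is a nucleus.

    The same description yields the key fact ([pi_set_right_adjoint]): a frame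
    homomorphism [m] is skinny only if its right adjoint sends [pi_set M] into
    [pi_set L].  Two consequences carry the statement.  Applied to the second
    of two skinny maps, it gives their composition.  Applied to a skinny
    [f : L -> M] with [M] pointless, where [pi_set M] is all of [M], it gives
    [f (pi_map b) = f b], so that [f] factors through the quotient
    [L -> pi_set L], uniquely because the quotient is onto.

    For surjections there are two transfers of points.  The right adjoint of
    any frame homomorphism sends maximal elements to maximal elements, since it
    preserves primes; this gives the cancellation property, and it shows that
    [pi_set L] is pointless: a maximal element of [pi_set L] would be maximal
    in [L], with successor [\top].  And a surjection sends a maximal element to
    [\top] or to a maximal element, which makes it skinny.  The quotient onto
    [pi_set L] is a surjection, so it is skinny and an epimorphism, and a
    homomorphism out of it is skinny as soon as its composite with the quotient
    is. *)

Set Implicit Arguments.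
Unset Strict Implicit.
Unset Printing Implicit Defensive.
Import Order.TTheory.
Local Open Scope classical_set_scope.
Local Open Scope order_scope.

(** * Joins and right adjoints *)

Section BigJoin.
Context {d : Order.disp_t} {L : frameType d}.
Implicit Types (a b c x y : L) (A : set L).

Lemma bigjoin_ub A a : A a -> a <= bigjoin A.
Proof. by have [ub _] := bigjoinP A; apply: ub. Qed.

Lemma bigjoin_le A b : (forall a, A a -> a <= b) -> bigjoin A <= b.
Proof. by have [_ lb] := bigjoinP A => Ab; apply: lb. Qed.

Lemma bigmeet_lb A a : A a -> bigmeet A <= a.
Proof. by move=> Aa; apply: bigjoin_le => x; apply. Qed.

Lemma bigmeet_ge A b : (forall a, A a -> b <= a) -> b <= bigmeet A.
Proof. exact: bigjoin_ub. Qed.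

Lemma bigjoin2 a b : bigjoin [set a; b] = a `|` b.
Proof.
apply/le_anti/andP; split; last first.
  by rewrite leUx !bigjoin_ub //; [right|left].
by apply: bigjoin_le => x [->|->]; [exact: leUl|exact: leUr].
Qed.

Lemma le_pseudocompl a x : (x <= pseudocompl a) = (a `&` x == \bot).
Proof.
apply/idP/eqP => [xa|ax0]; last exact: bigjoin_ub.
apply/eqP; rewrite -lex0; apply: (le_trans (leI2 (lexx a) xa)).
rewrite meet_bigjoin; apply: bigjoin_le => _ [y ay0 <-].
by rewrite ay0.
Qed.

Lemma meet_pseudocompl a : a `&` pseudocompl a = \bot.
Proof. by apply/eqP; rewrite -le_pseudocompl. Qed.

End BigJoin.

Section RightAdjoint.
Context {d d' : Order.disp_t} {L : frameType d} {M : frameType d'}.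
Implicit Types (m : L -> M) (x : L) (y : M).

Definition preserves_bigjoin m := forall A : set L,
  m (bigjoin A) = bigjoin (m @` A).

Definition right_adjoint m y : L := bigjoin [set x | m x <= y].

Lemma preserves_bigjoin_homo m :
  preserves_bigjoin m -> {homo m : x y / x <= y}.
Proof.
move=> mJ x y /join_idPl <-; rewrite -bigjoin2 mJ.
by apply: bigjoin_ub; exists x => //; right.
Qed.

Lemma right_adjointP m : preserves_bigjoin m ->
  forall x y, (x <= right_adjoint m y) = (m x <= y).
Proof.
move=> mJ x y; apply/idP/idP => [xy|]; last exact: bigjoin_ub.
apply: le_trans (preserves_bigjoin_homo mJ xy) _; rewrite mJ.
by apply: bigjoin_le => _ [z zy <-].
Qed.

End RightAdjoint.

(** Heyting implication; [meet_bigjoin] says exactly that meeting with [a]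
    preserves joins. *)
Definition himpl d (L : frameType d) (a b : L) : L :=
  right_adjoint (Order.meet a) b.

Lemma himplP d (L : frameType d) (a b x : L) :
  (x <= himpl a b) = (a `&` x <= b).
Proof. by rewrite right_adjointP // => A; rewrite meet_bigjoin. Qed.

(** * Regularity *)

Section RatherBelow.
Context {d : Order.disp_t} {L : frameType d}.
Implicit Types (a b : L).

Lemma rather_below_le a b : rather_below a b -> a <= b.
Proof.
move=> ab; rewrite -[a]meetx1 -ab meetUr leUx leIr andbT.
by rewrite meet_pseudocompl le0x.
Qed.

Lemma completely_below_rather a b : completely_below a b -> rather_below a b.
Proof. by move=> [c [<- <- cP]]; apply: cP. Qed.

End RatherBelow.

Section RatherBelowMorph.
Context {d d' : Order.disp_t} {L : frameType d} {M : frameType d'} (m : L -> M).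
Hypotheses (m0 : m \bot = \bot) (m1 : m \top = \top).
Hypothesis mI : {morph m : x y / x `&` y}.
Hypothesis mU : {morph m : x y / x `|` y}.

Lemma rather_below_morph a b : rather_below a b -> rather_below (m a) (m b).
Proof.
move=> ab; apply/eqP; rewrite -le1x -m1 -ab mU leU2 // le_pseudocompl -mI.
by rewrite meet_pseudocompl m0.
Qed.

Lemma completely_below_morph a b :
  completely_below a b -> completely_below (m a) (m b).
Proof.
move=> [c [<- <- cP]]; exists (m \o c); split=> // p q p0 pq q1.
exact/rather_below_morph/cP.
Qed.

End RatherBelowMorph.

(** * Points as maximal and as prime elements *)

Definition prime_elt d (L : frameType d) (p : L) : Prop :=
  p != \top /\ forall x y, x `&` y <= p -> x <= p \/ y <= p.

Lemma max_joinT d (L : frameType d) (p x : L) :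
  max_set L p -> ~~ (x <= p) -> x `|` p = \top.
Proof.
move=> [p1 pmax] xp; apply/eqP; apply: contraNT xp => xp1.
by rewrite -(pmax _ xp1 (leUr _ _)) leUl.
Qed.

Lemma max_prime d (L : frameType d) (p : L) : max_set L p -> prime_elt p.
Proof.
move=> pmax; split=> [|x y xyp]; first by case: pmax.
have [xp|/(max_joinT pmax) xp] := boolP (x <= p); first by left.
have [yp|/(max_joinT pmax) yp] := boolP (y <= p); first by right.
have : (x `&` y) `|` p = \top by rewrite joinIl xp yp meetxx.
by rewrite (join_idPr xyp) => p1; case: pmax; rewrite p1 eqxx.
Qed.

(** This is where regularity is used: if [a] is rather below [y], then [a] and
    its pseudocomplement meet in [\bot], so a prime [p <= y] lies above one of
    them, and it cannot be the pseudocomplement unless [y] is [\top]. *)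
Lemma prime_max d (L : crFrameType d) (p : L) : prime_elt p -> max_set L p.
Proof.
move=> [p1 pP]; split=> // y y1 py; apply/le_anti/andP; split=> //.
rewrite [y]completely_regularP; apply: bigjoin_le => a.
move=> /completely_below_rather ay.
have [||a'p] := pP a (pseudocompl a).
- by rewrite meet_pseudocompl le0x.
- by [].
- by case/eqP: y1; rewrite -ay (join_idPr (le_trans a'p py)).
Qed.

(** * The description of [pi_set] by points *)

Section PiSet.
Context {d : Order.disp_t} {L : crFrameType d}.
Implicit Types (a b c p x z : L).

Lemma successor_between a b c :
  successor a c -> a <= b -> b <= c -> b = a \/ b = c.
Proof.
move=> [_ acP] ab bc.
have [->|ba] := eqVneq b a; first by left.
have [->|nbc] := eqVneq b c; first by right.
by case: acP; exists b; rewrite !lt_neqAle ab bc nbc eq_sym ba.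
Qed.

(** Below [c], each [x] gives an element [(c `&` x) `|` a] between [a] and [c],
    so it is [a] or [c]; it is [a] exactly when [x <= himpl c a].  Two elements
    not below [himpl c a] both give [c], and hence so does their meet. *)
Lemma successor_prime a c : successor a c -> prime_elt (himpl c a).
Proof.
move=> ac; have [ltac _] := ac.
have nca : ~~ (c <= a) by rewrite lt_geF.
have joinP x : ~~ (x <= himpl c a) -> (c `&` x) `|` a = c.
  rewrite himplP => cxa.
  have [||E|//] := @successor_between a ((c `&` x) `|` a) c ac.
  - exact: leUr.
  - by rewrite leUx leIl ltW.
  - by rewrite -E leUl in cxa.
split=> [|x y].
  by rewrite -le1x himplP meetx1.
rewrite himplP => cxya.
have [|/joinP cx] := boolP (x <= himpl c a); first by left.
have [|/joinP cy] := boolP (y <= himpl c a); first by right.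
have : ((c `&` x) `|` a) `&` ((c `&` y) `|` a) <= a.
  by rewrite -joinIl meetACA meetxx leUx cxya /=.
by rewrite cx cy meetxx (negPf nca).
Qed.

(** An element [b] strictly between [a] and [c `|` a] is placed by [p]: either
    [b <= p], and then [b] is below [(c `|` a) `&` p <= a], or [b `|` p] is
    [\top], and then [c `|` a] is below [b]. *)
Lemma max_join_successor a c p :
  max_set L p -> c `&` p <= a -> ~~ (c <= a) -> successor a (c `|` a).
Proof.
move=> pmax cpa ca; split.
  rewrite lt_neqAle leUr andbT; apply: contraNneq ca => E.
  by rewrite E leUl.
move=> [b /andP[ab bc]].
have cap : (c `|` a) `&` p <= a by rewrite meetUl leUx cpa leIl.
have [bp|/(max_joinT pmax) bp] := boolP (b <= p).
  have : b <= a by apply: le_trans cap; rewrite lexI (ltW bc) bp.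
  by rewrite lt_geF.
have : c `|` a <= b.
  rewrite -[X in X <= _]meetx1 -bp meetUr leUx leIr.
  exact: le_trans cap (ltW ab).
by rewrite lt_geF.
Qed.

(** The condition on [p] says that [himpl p a <= a], that is, [a] belongs to
    the open sublocale of [p]. *)
Lemma pi_setP a :
  pi_set L a <-> forall p c, max_set L p -> c `&` p <= a -> c <= a.
Proof.
split=> [asucc p c pmax cpa|aP [c ac]].
  apply: contrapT => /negP ca; apply: asucc; exists (c `|` a).
  exact: max_join_successor pmax cpa ca.
have : c <= a.
  apply: aP (prime_max (successor_prime ac)) _.
  by rewrite -himplP.
by case: ac => ac _; rewrite lt_geF.
Qed.

Lemma pi_set_himpl x z : pi_set L z -> pi_set L (himpl x z).
Proof.
move=> /pi_setP zP; apply/pi_setP => p c pmax.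
by rewrite !himplP meetA; apply: zP.
Qed.

Lemma pi_set_bigmeet (A : set L) :
  (forall a, A a -> pi_set L a) -> pi_set L (bigmeet A).
Proof.
move=> AP; apply/pi_setP => p c pmax cpA; apply: bigmeet_ge => a Aa.
move/AP: (Aa) => /pi_setP/(_ p c pmax); apply.
exact: le_trans cpA (bigmeet_lb Aa).
Qed.

Lemma pi_mapP z b : pi_set L z -> (pi_map b <= z) = (b <= z).
Proof.
move=> zP; apply/idP/idP => [|bz]; last exact: bigmeet_lb.
by apply: le_trans; apply: bigmeet_ge => a [].
Qed.

Lemma pi_set_pi_map b : pi_set L (pi_map b).
Proof. by apply: pi_set_bigmeet => a []. Qed.

Lemma le_pi_map b : b <= pi_map b.
Proof. by rewrite -pi_mapP //; exact: pi_set_pi_map. Qed.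

Lemma pi_map_id z : pi_set L z -> pi_map z = z.
Proof. by move=> zP; apply/le_anti; rewrite le_pi_map pi_mapP // lexx. Qed.

Lemma pi_mapTP b :
  pi_map b = \top <-> forall z, pi_set L z -> b <= z -> z = \top.
Proof.
split=> [b1 z zP|]; last by apply; [exact: pi_set_pi_map|exact: le_pi_map].
by rewrite -pi_mapP // b1 le1x => /eqP.
Qed.

(** Implication moves one argument of the meet at a time to the right-hand
    side, where stability under implication allows applying [pi_map] to the
    other. *)
Lemma pi_mapI : {morph @pi_map d L : a b / a `&` b}.
Proof.
move=> a b; apply/le_anti/andP; split.
  rewrite lexI !pi_mapP; try exact: pi_set_pi_map.
  by rewrite (le_trans (leIl _ _) (le_pi_map _))
             (le_trans (leIr _ _) (le_pi_map _)).
have zP : pi_set L (pi_map (a `&` b)) by exact: pi_set_pi_map.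
rewrite -himplP pi_mapP; last exact: pi_set_himpl.
rewrite himplP meetC -himplP pi_mapP; last exact: pi_set_himpl.
by rewrite himplP meetC le_pi_map.
Qed.

Lemma max_notin_pi_set a : max_set L a -> ~ pi_set L a.
Proof.
move=> amax /pi_setP/(_ a \top amax); rewrite meet1x => /(_ (lexx a)).
by case: amax; rewrite le1x => /negP.
Qed.

Lemma pointless_pi_set : pointless L -> forall a, pi_set L a.
Proof.
move=> noL a; apply/pi_setP => p c pmax.
by have : (@set0 L) p by rewrite -noL.
Qed.

End PiSet.

(** * Skinny homomorphisms *)

Section FrameHom.
Context {d d' : Order.disp_t} {L : crFrameType d} {M : crFrameType d'}.
Implicit Types (m : L -> M).

Lemma frame_hom_adjoint m : frame_hom m ->
  forall x y, (x <= right_adjoint m y) = (m x <= y).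
Proof. by move=> [_ _ mJ]; apply: right_adjointP. Qed.

Lemma surj_right_adjointK m :
  frame_surjection m -> cancel (right_adjoint m) m.
Proof.
move=> [mhom msurj] y; have [x _ <-] := msurj y I.
have [_ _ mJ] := mhom.
apply/le_anti; rewrite -frame_hom_adjoint // lexx /=.
by apply: preserves_bigjoin_homo mJ _ _ _; rewrite frame_hom_adjoint.
Qed.

(** Preimages of points are points: the right adjoint preserves primes, and
    primes are maximal. *)
Lemma max_right_adjoint m (q : M) :
  frame_hom m -> max_set M q -> max_set L (right_adjoint m q).
Proof.
move=> mhom /max_prime[q1 qP]; have [m1 mI _] := mhom.
apply: prime_max; split=> [|x y].
  by rewrite -le1x frame_hom_adjoint // m1 le1x.
by rewrite !frame_hom_adjoint // mI; apply: qP.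
Qed.

(** By [pi_setP] one must discard a maximal [p] from [c `&` p <= m^* z], that
    is from [m c `&` m p <= z]; this inequality says that [m p] lies below the
    element [himpl (m c) z] of [pi_set M], which is [\top] when [m] is
    skinny. *)
Lemma pi_set_right_adjoint m (z : M) :
  skinny m -> pi_set M z -> pi_set L (right_adjoint m z).
Proof.
move=> [mhom mskinny] zP; have [_ mI _] := mhom.
apply/pi_setP => p c pmax; rewrite !frame_hom_adjoint // mI -himplP => mpz.
have implP : pi_set M (himpl (m c) z) by exact: pi_set_himpl.
have /pi_mapTP/(_ _ implP mpz) impl1 := mskinny _ pmax.
by rewrite -[m c]meetx1 -himplP impl1.
Qed.

Lemma surjection_skinny m : frame_surjection m -> skinny m.
Proof.
move=> msurj; have [mhom _] := msurj; have mK := surj_right_adjointK msurj.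
have [m1 _ _] := mhom.
split=> // a [a1 amax].
(* Every element above [m a] is [m a] itself or [\top]. *)
have above y : m a <= y -> y != \top -> y = m a.
  move=> may y1; rewrite -[LHS]mK; congr (m _).
  apply: amax; last by rewrite frame_hom_adjoint.
  by apply: contraNneq y1 => E; rewrite -(mK y) E m1.
apply/pi_mapTP => z zP maz; apply: contrapT => /eqP z1.
suff : max_set M z by move=> /max_notin_pi_set.
split=> // y y1 zy; rewrite (above z) // (above y) //.
exact: le_trans zy.
Qed.

Lemma frame_iso_surjection m : frame_iso m -> frame_surjection m.
Proof. by move=> [mhom [n [_ _ nK]]]; split=> // y _; exists (n y). Qed.

(** A skinny map to a pointless frame does not see the difference between
    [b] and [pi_map b], because its right adjoint takes values in [pi_set]. *)
Lemma skinny_pi_map m :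
  pointless M -> skinny m -> forall b, m (pi_map b) = m b.
Proof.
move=> noM mskinny b; have [mhom _] := mskinny.
apply/le_anti; rewrite -frame_hom_adjoint // pi_mapP.
  have [_ _ mJ] := mhom.
  rewrite frame_hom_adjoint // lexx /=.
  by apply: preserves_bigjoin_homo mJ _ _ _; exact: le_pi_map.
apply: pi_set_right_adjoint => //; exact: pointless_pi_set.
Qed.

End FrameHom.

Section Composition.
Context {d d' d'' : Order.disp_t}.
Context {L : crFrameType d} {M : crFrameType d'} {N : crFrameType d''}.

Lemma frame_hom_comp (m : L -> M) (n : M -> N) :
  frame_hom m -> frame_hom n -> frame_hom (n \o m).
Proof.
move=> [m1 mI mJ] [n1 nI nJ]; split=> [|x y|A] /=.
- by rewrite m1 n1.
- by rewrite mI nI.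
- by rewrite mJ nJ image_comp.
Qed.

Lemma skinny_comp (m : L -> M) (n : M -> N) :
  skinny m -> skinny n -> skinny (n \o m).
Proof.
move=> [mhom mskinny] nskinny; have [nhom _] := nskinny.
split=> [|a amax]; first exact: frame_hom_comp.
apply/pi_mapTP => z zP; rewrite -(frame_hom_adjoint nhom) => maz.
have adjP : pi_set M (right_adjoint n z) by exact: pi_set_right_adjoint.
have /pi_mapTP/(_ _ adjP maz) E := mskinny _ amax.
apply/eqP; rewrite -le1x; case: nhom (nhom) => <- _ _ nhom.
by rewrite -frame_hom_adjoint // E.
Qed.

Lemma skinny_cancel (e : L -> M) (m : M -> N) :
  frame_surjection e -> frame_hom m -> skinny (m \o e) -> skinny m.
Proof.
move=> esurj mhom [_ meskinny]; split=> // b bmax.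
rewrite -(surj_right_adjointK esurj b); apply: meskinny.
by case: esurj => ehom _; apply: max_right_adjoint.
Qed.

End Composition.

(** * Sublocales as completely regular frames *)

Definition nucleus d (L : frameType d) (j : L -> L) : Prop :=
  [/\ forall a, a <= j a, forall a, j (j a) <= j a &
      {morph j : a b / a `&` b}].

Section Sublocale.
Context {d : Order.disp_t} {L : crFrameType d} (j : L -> L) (jN : nucleus j).

(** The frame structure on the fixed points is built from the nucleus axioms, so
    the type carries the proof [N] for the canonical instances to find. *)
Record sublocale (N : nucleus j) := Sublocale {
  sublocale_val : L;
  _ : j sublocale_val == sublocale_val
}.
Local Notation S := (sublocale jN).

HB.instance Definition _ := [isSub of S for @sublocale_val jN].
HB.instance Definition _ := [Choice of S by <:].
HB.instance Definition _ := [SubChoice_isSubPOrder of S by <: with d].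

Lemma nucleus_ge a : a <= j a. Proof. by case: jN. Qed.

Lemma nucleusI : {morph j : a b / a `&` b}. Proof. by case: jN. Qed.

Lemma nucleusK a : j (j a) = j a.
Proof. by apply/le_anti; rewrite nucleus_ge andbT; case: jN. Qed.

Lemma nucleus_homo : {homo j : a b / a <= b}.
Proof. by move=> a b /meet_idPl ab; rewrite -ab nucleusI leIr. Qed.

Lemma sublocale_fix (x : S) : j (val x) = val x.
Proof. by apply/eqP; exact: (valP x). Qed.

Definition to_sublocale (a : L) : S := Sublocale jN (introT eqP (nucleusK a)).

Lemma val_to_sublocale a : val (to_sublocale a) = j a.
Proof. by rewrite SubK. Qed.

Lemma to_sublocaleK : cancel val to_sublocale.
Proof. by move=> x; apply: val_inj; rewrite val_to_sublocale sublocale_fix. Qed.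

Lemma leEsublocale (x y : S) : (x <= y) = (val x <= val y).
Proof. by rewrite leEsub. Qed.

Lemma to_sublocale_le a (x : S) : (to_sublocale a <= x) = (a <= val x).
Proof.
rewrite leEsublocale val_to_sublocale; apply/idP/idP.
  exact: le_trans (nucleus_ge a).
by rewrite -{2}(sublocale_fix x); exact: nucleus_homo.
Qed.

Let meetS (x y : S) := to_sublocale (val x `&` val y).
Let joinS (x y : S) := to_sublocale (val x `|` val y).

Let val_meetS x y : val (meetS x y) = val x `&` val y.
Proof. by rewrite val_to_sublocale nucleusI !sublocale_fix. Qed.

Let meetSP x y z : (x <= meetS y z) = (x <= y) && (x <= z).
Proof. by rewrite !leEsublocale val_meetS lexI. Qed.

Let joinSP x y z : (joinS x y <= z) = (x <= z) && (y <= z).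
Proof. by rewrite to_sublocale_le leUx !leEsublocale. Qed.

HB.instance Definition _ :=
  Order.POrder_MeetJoin_isLattice.Build d S meetSP joinSP.

Lemma val_sublocaleI (x y : S) : val (x `&` y) = val x `&` val y.
Proof. exact: val_meetS. Qed.

Lemma to_sublocaleI : {morph to_sublocale : a b / a `&` b}.
Proof.
move=> a b; apply: val_inj.
by rewrite val_sublocaleI !val_to_sublocale nucleusI.
Qed.

Lemma to_sublocaleU : {morph to_sublocale : a b / a `|` b}.
Proof.
move=> a b; apply/le_anti.
rewrite to_sublocale_le leUx -!to_sublocale_le leUl leUr /=.
by rewrite leUx !to_sublocale_le !(le_trans _ (nucleus_ge _)) ?leUl ?leUr.
Qed.

Let meetSUl : @left_distributive S S Order.meet Order.join.
Proof.
move=> x y z; rewrite -[x]to_sublocaleK -[y]to_sublocaleK -[z]to_sublocaleK.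
by rewrite -!(to_sublocaleI, to_sublocaleU) meetUl.
Qed.

HB.instance Definition _ :=
  Order.Lattice_Meet_isDistrLattice.Build d S meetSUl.

Let le0S (x : S) : to_sublocale \bot <= x.
Proof. by rewrite to_sublocale_le. Qed.

Let leS1 (x : S) : x <= to_sublocale \top.
Proof. by rewrite leEsublocale (le_trans (lex1 _)) ?nucleus_ge. Qed.

HB.instance Definition _ := Order.hasBottom.Build d S le0S.
HB.instance Definition _ := Order.hasTop.Build d S leS1.

Let bigjoinS (A : set S) := to_sublocale (bigjoin (val @` A)).

Let bigjoinSP (A : set S) : supremums A (bigjoinS A).
Proof.
split=> [x Ax|y Ay].
  rewrite leEsublocale (le_trans _ (nucleus_ge _)) //.
  by apply: bigjoin_ub; exists x.
rewrite to_sublocale_le; apply: bigjoin_le => _ [x Ax <-].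
by rewrite -leEsublocale; apply: Ay.
Qed.

Let meet_bigjoinS (x : S) (A : set S) :
  x `&` bigjoinS A = bigjoinS [set x `&` a | a in A].
Proof.
rewrite -{1}[x]to_sublocaleK -to_sublocaleI meet_bigjoin /bigjoinS !image_comp.
congr (to_sublocale (bigjoin _)); apply: eq_imagel => y _.
exact/esym/val_sublocaleI.
Qed.

HB.instance Definition _ :=
  TBDistrLattice_isFrame.Build d S bigjoinSP meet_bigjoinS.

Lemma val_sublocale1 : val (\top : S) = j \top.
Proof. exact: val_to_sublocale. Qed.

Lemma val_bigjoin_sublocale (A : set S) :
  val (bigjoin A) = j (bigjoin (val @` A)).
Proof. exact: val_to_sublocale. Qed.

Let completely_regularS (b : S) :
  b = bigjoin [set a : S | completely_below a b].
Proof.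
apply/le_anti/andP; split; last first.
  by apply: bigjoin_le => a /completely_below_rather; apply: rather_below_le.
rewrite -{1}[b]to_sublocaleK to_sublocale_le {1}[val b]completely_regularP.
apply: bigjoin_le => a ab; rewrite -to_sublocale_le; apply: bigjoin_ub.
rewrite /= -[b]to_sublocaleK; apply: completely_below_morph ab => //.
- exact: to_sublocaleI.
- exact: to_sublocaleU.
Qed.

HB.instance Definition _ :=
  Frame_isCompletelyRegular.Build d S completely_regularS.

Lemma to_sublocale_surjection : frame_surjection (to_sublocale : L -> S).
Proof.
split; last by move=> x _; exists (val x) => //; exact: to_sublocaleK.
split=> [//||A]; first exact: to_sublocaleI.
apply/le_anti; rewrite to_sublocale_le; apply/andP; split.
  by apply: bigjoin_le => a Aa; rewrite -to_sublocale_le; apply: bigjoin_ub;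
    exists a.
apply: bigjoin_le => _ [a Aa <-]; rewrite to_sublocale_le.
by apply: le_trans (nucleus_ge _); exact: bigjoin_ub.
Qed.

(** Joins and the top of the sublocale are those of [L] followed by [j], so [f]
    preserves them on the sublocale because it absorbs [j]. *)
Lemma frame_hom_val d' (M : crFrameType d') (f : L -> M) :
  frame_hom f -> (forall a, f (j a) = f a) -> frame_hom (f \o val : S -> M).
Proof.
move=> [f1 fI fJ] fj; rewrite /comp; split=> [|x y|A].
- by rewrite val_sublocale1 fj.
- by rewrite val_sublocaleI fI.
- by rewrite val_bigjoin_sublocale fj fJ image_comp.
Qed.

End Sublocale.

(** * The pointless reflection *)

Section PointlessReflection.
Context {d : Order.disp_t} (L : crFrameType d).

Lemma pi_map_nucleus : nucleus (@pi_map d L).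
Proof.
split; [exact: le_pi_map| |exact: pi_mapI].
by move=> a; rewrite pi_map_id //; exact: pi_set_pi_map.
Qed.

Definition pi_frame : crFrameType d := sublocale pi_map_nucleus.
Definition pi_quotient : L -> pi_frame := to_sublocale pi_map_nucleus.

Lemma pi_quotient_surjection : frame_surjection pi_quotient.
Proof. exact: to_sublocale_surjection. Qed.

Lemma pi_quotient_skinny : skinny pi_quotient.
Proof. exact: surjection_skinny pi_quotient_surjection. Qed.

(** A maximal element of the quotient, pulled back along the quotient map,
    would be an element of [pi_set L] that is maximal in [L]. *)
Lemma pi_frame_pointless : pointless pi_frame.
Proof.
rewrite /pointless -subset0 => q qmax.
have [rhom _] := pi_quotient_surjection.
apply: (max_notin_pi_set (max_right_adjoint rhom qmax)).
suff -> : right_adjoint pi_quotient q = val q.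
  by rewrite -sublocale_fix; exact: pi_set_pi_map.
have adjE x : (x <= right_adjoint pi_quotient q) = (x <= val q).
  by rewrite frame_hom_adjoint // to_sublocale_le.
by apply/le_anti; rewrite -adjE lexx adjE lexx.
Qed.

Lemma pi_quotient_epi : Fs_epi pi_quotient.
Proof.
split=> [|d'' N f g _ _ fg]; first exact: pi_quotient_skinny.
apply/funext => y; rewrite -[y]to_sublocaleK.
exact: (congr1 (@^~ (val y)) fg).
Qed.

Lemma pi_quotient_reflection : Fs_reflection (@pointless) pi_quotient.
Proof.
split=> [||d'' M f noM fskinny].
- exact: pi_frame_pointless.
- exact: pi_quotient_skinny.
have factor : (f \o val) \o pi_quotient = f.
  by apply/funext => a; apply: skinny_pi_map.
exists (f \o val); split=> [|g [_ gf]].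
  split=> //; apply: skinny_cancel pi_quotient_surjection _ _.
    by apply: frame_hom_val; [case: fskinny|exact: skinny_pi_map].
  by rewrite factor.
by rewrite -gf; apply/funext => y /=; rewrite /pi_quotient to_sublocaleK.
Qed.

End PointlessReflection.

(** In particular, the pointless frames are closed under isomorphism. *)
Lemma pointless_hom d d' (L : crFrameType d) (M : crFrameType d') (m : L -> M) :
  frame_hom m -> pointless L -> pointless M.
Proof.
move=> mhom noL; rewrite /pointless -subset0 => q qmax.
have : max_set L (right_adjoint m q) by exact: max_right_adjoint.
by rewrite noL.
Qed.

Theorem corollary4p1p2 :
  (forall (d d' : Order.disp_t) (L : crFrameType d) (M : crFrameType d')
     (m : L -> M), frame_iso m -> skinny m) /\
  (forall (d d' : Order.disp_t) (L : crFrameType d) (M : crFrameType d')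
     (m : L -> M), frame_surjection m -> skinny m) /\
  (forall (d d' d'' : Order.disp_t) (L : crFrameType d) (M : crFrameType d')
     (N : crFrameType d'') (m : L -> M) (n : M -> N),
     skinny m -> skinny n -> skinny (n \o m)) /\
  (forall (d d' d'' : Order.disp_t) (L : crFrameType d) (M : crFrameType d')
     (N : crFrameType d'') (e : L -> M) (m : M -> N),
     frame_surjection e -> frame_hom m -> skinny (m \o e) -> skinny m) /\
  Fs_epireflective (@pointless).
Proof.
split=> [d d' L M m /frame_iso_surjection|]; first exact: surjection_skinny.
split=> [d d' L M m|]; first exact: surjection_skinny.
split=> [d d' d'' L M N m n mS nS|]; first exact: skinny_comp mS nS.
split=> [d d' d'' L M N e m eS mhom|].
  exact: skinny_cancel eS mhom.
split=> [d d' L M m [[mhom _] _]|d L]; first exact: pointless_hom mhom.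
exists d, (pi_frame L), (@pi_quotient d L).
split; [exact: pi_quotient_reflection|exact: pi_quotient_epi].
Qed.
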